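(* The following lower bounds hold: $a_{10}\ge 259$, $a_{11}\ge 739$, $a_{12}\ge 2107$, $a_{13}\ge 6157$.
   Context: For a positive integer $n$, $\mathcal{A}_n$ denotes the set of $n\times n$ matrices with all entries in $\{0,1\}$, and $\mathcal{D}_n=\{|\det A| : A\in\mathcal{A}_n\}$ (determinants computed over the integers). $a_n$ denotes the smallest positive integer not in $\mathcal{D}_n$. *)

(* Defs.v *)
From mathcomp Require Import all_boot all_order all_algebra.

Set Implicit Arguments.
Unset Strict Implicit.
Unset Printing Implicit Defensive.

Import GRing.Theory.
Local Open Scope ring_scope.

Definition zero_one_mx (n : nat) : {pred 'M[int]_n} :=
  [pred A : 'M[int]_n | [forall i, forall j, A i j \in [:: 0; 1]]].
Arguments zero_one_mx n : clear implicits.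

Definition det_spectrum (n d : nat) : Prop :=
  exists2 A : 'M[int]_n, A \in zero_one_mx n & `|\det A|%N = d.

(* Boolean matrices enumerate the zero-one integer matrices, which makes
   [det_spectrum n] decidable and bounded. *)
Definition int_of_bool_mx (n : nat) (B : 'M[bool]_n) : 'M[int]_n :=
  map_mx (fun b : bool => (b : nat)%:Z) B.

Lemma det_spectrumP (n d : nat) :
  reflect (det_spectrum n d)
          [exists B : 'M[bool]_n, `|\det (int_of_bool_mx B)|%N == d].
Proof.
apply: (iffP existsP) => [[B /eqP detB] | [A A01 detA]].
  exists (int_of_bool_mx B) => //.
  by apply/forallP=> i; apply/forallP=> j; rewrite mxE; case: (B i j).
exists (map_mx (fun x : int => x == 1) A); rewrite -detA.
suff -> : int_of_bool_mx (map_mx (fun x : int => x == 1) A) = A by [].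
apply/matrixP=> i j; rewrite !mxE.
by move/forallP/(_ i)/forallP/(_ j): A01; rewrite !inE => /orP[] /eqP ->.
Qed.

Definition det_spectrum_dec (n d : nat) : decidable (det_spectrum n d) :=
  decP (det_spectrumP n d).

Lemma missing_det_exists (n : nat) :
  exists d, (0 < d)%N && ~~ det_spectrum_dec n d.
Proof.
exists (\max_(B : 'M[bool]_n) `|\det (int_of_bool_mx B)|%N).+1 => /=.
apply/negP=> /sumboolP/det_spectrumP/existsP[B /eqP detB].
by have := leq_bigmax (F := fun B => `|\det (int_of_bool_mx B)|%N) B;
   rewrite /= detB ltnn.
Qed.

Definition smallest_missing_det (n : nat) : nat :=
  ex_minn (missing_det_exists n).

Lemma smallest_missing_detP (n : nat) :
  [/\ (0 < smallest_missing_det n)%N,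
      ~ det_spectrum n (smallest_missing_det n) &
      forall d, (0 < d)%N -> ~ det_spectrum n d ->
        (smallest_missing_det n <= d)%N].
Proof.
rewrite /smallest_missing_det.
case: ex_minnP => m /andP[m_gt0 /sumboolP Dm] min_m; split=> // d d_gt0 Dd.
by apply: min_m; rewrite d_gt0; apply/sumboolP.
Qed.

(* Main.v *)
Require Import Defs.
From mathcomp Require Import all_boot all_order all_algebra.
From Stdlib Require Import ZArith.
From mathcomp Require Import zify ssrZ.

Import GRing.Theory.

(** Fix the first [n] rows of a zero-one matrix of order [n.+1] and let the last
    row [x] vary: expanding along [x] gives [\det A = \sum_j x_j c_j], where the
    [c_j] are the signed cofactors, which do not depend on [x].  Hence every
    subset sum of [c] is a determinant, and one choice of [n] rows yields up to
    [2 ^ n.+1] determinants at once.  A few well-chosen partial matrices, found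
    by simulated annealing, are therefore enough to realise every value below
    the stated bounds, and what remains is to certify their subset sums.

    The cofactors are certified without expanding a determinant.  Cramer's rule
    gives, for each [j], an integer vector [u_j] supported on the coordinates
    [0 .. j], annihilated by rows [0 .. j-1], whose last coordinate is the
    leading principal minor of order [j].  Put as columns of a matrix [U] they
    make both [U] and [A *m U] triangular, and the diagonal of [A *m U] is the
    diagonal of [U] shifted by one place; taking determinants, everything
    cancels except the last entry, the dot
    product of [x] and [u_n] ([det_of_kernel_columns]).  The
    vector [u_n] is the cofactor vector [c].  Only the triangular shape and the
    shifted diagonal have to be checked, so the elimination that produces the
    columns needs no correctness proof ([det_certified]).

    Finally a set of natural numbers is represented by the binary digits of an
    integer, so that adding [a] to all its elements is a shift by [a]; the
    subset sums of [c] are then obtained by as many shifts and disjunctions as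
    [c] has entries ([subset_sumsP]), and the fact that all values below [k] are
    reached is one equality between integers ([covers], [coversP]). *)

(** * Determinants from nested kernel vectors *)

(** If [D_j] are the leading principal minors of [A], then [U] has diagonal
    [D_0, .., D_n] and [A *m U] has diagonal [D_1, .., D_n, \det A]; the
    products of the two diagonals telescope. *)
Lemma det_of_kernel_columns (R : idomainType) (n : nat) (A U : 'M[R]_n.+1) :
    is_trig_mx U^T -> is_trig_mx (A *m U) -> U ord0 ord0 = 1%R ->
    (forall i : 'I_n, (A *m U)%R (lift ord_max i) (lift ord_max i)
                      = U (lift ord0 i) (lift ord0 i)) ->
    (forall i, U i i != 0%R) ->
  (\det A)%R = (A *m U)%R ord_max ord_max.
Proof.
move=> trigU trigAU U00 AUU Uneq0.
have prodU_neq0 : (\prod_i U i i != 0)%R by apply/prodf_neq0.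
apply: (mulIf prodU_neq0).
have detU : (\det U = \prod_i U i i)%R.
  by rewrite -det_tr det_trig //; apply: eq_bigr => i _; rewrite mxE.
rewrite -{1}detU -det_mulmx (det_trig trigAU) big_ord_recr mulrC /=.
rewrite big_ord_recl U00 mul1r; congr (_ * _)%R.
apply: eq_bigr => i _; rewrite -AUU.
have -> : widen_ord (leqnSn n) i = lift ord_max i by apply/val_inj/esym/lift_max.
by [].
Qed.

(** * Certified cofactors of a partial zero-one matrix *)

Fixpoint dot (r : seq bool) (u : seq Z) : Z :=
  if r is b :: r' then
    if u is a :: u' then (if b then a + dot r' u' else dot r' u')%Z else 0%Z
  else 0%Z.

Lemma dotE (n : nat) (r : seq bool) (u : seq Z) : size u <= n ->
  dot r u = (\sum_(j < n) (nth false r j)%:R * nth 0%Z u j)%R.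
Proof.
elim: r u n => [|b r IHr] u n; first by rewrite big1 // => j; rewrite nth_nil mul0r.
case: u => [|a u]; first by rewrite big1 // => j; rewrite nth_nil mulr0.
case: n => // n le_un.
rewrite big_ord_recl /= (IHr u n) //.
by case: b; rewrite ?mul1r ?mul0r ?add0r.
Qed.

Lemma dot_opp (r : seq bool) (u : seq Z) :
  dot r (map Z.opp u) = Z.opp (dot r u).
Proof.
elim: r u => [|b r IHr] [|a u] //=; rewrite IHr.
by case: b; rewrite ?Z.opp_add_distr.
Qed.

Definition bool_mx_of_rows (n : nat) (rows : seq (seq bool)) : 'M[bool]_n :=
  (\matrix_(i, j) nth false (nth [::] rows i) j)%R.

(** The entrywise quotient [(q * y - v * u) / p], where a shorter [u] is padded
    with zeros. *)
Fixpoint eliminate (p q v : Z) (y u : seq Z) : seq Z :=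
  if y is a :: y' then
    if u is b :: u' then
      ((q * a - v * b) / p)%Z :: eliminate p q v y' u'
    else ((q * a) / p)%Z :: eliminate p q v y' [::]
  else [::].

(** Bareiss elimination performed on a single column [y]: it is made orthogonal
    to each row [r] in turn by means of the matching kernel column [u], and the
    division by the previous pivot [p] is exact and keeps the entries equal to
    minors. *)
Fixpoint reduce (p : Z) (y : seq Z) (rows : seq (seq bool))
    (cols : seq (seq Z)) : seq Z :=
  if rows is r :: rows' then
    if cols is u :: cols' then
      let q := dot r u in reduce q (eliminate p q (dot r y) y u) rows' cols'
    else y
  else y.

Fixpoint kernel_columns (rows : seq (seq bool)) (k : nat) : seq (seq Z) :=
  if k is k'.+1 then
    let cols := kernel_columns rows k' in
    rcons cols (reduce 1 (rcons (nseq k' 0%Z) 1%Z) rows cols)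
  else [::].

(** The hypotheses of [det_of_kernel_columns] for [n] fixed rows.  Column [j] is
    stored with its first [j.+1] entries only, so that the size condition
    expresses the triangularity of [U]. *)
Definition kernel_certificate (n : nat) (rows : seq (seq bool))
    (cols : seq (seq Z)) : bool :=
  [&& nth 0%Z (nth [::] cols 0) 0 == 1%Z,
      all (fun j => size (nth [::] cols j) == j.+1) (iota 0 n.+1) &
      all (fun i => let r := nth [::] rows i in
             [&& dot r (nth [::] cols i) == nth 0%Z (nth [::] cols i.+1) i.+1,
                 nth 0%Z (nth [::] cols i.+1) i.+1 != 0%Z &
                 all (fun j => dot r (nth [::] cols j) == 0%Z)
                     (iota i.+1 (n - i))])
          (iota 0 n)].

(** The certificate concerns the first [n] rows alone, whereas [x] is arbitrary:
    this is what makes the last column a vector of cofactors. *)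
Lemma det_certified (n : nat) (rows : seq (seq bool)) (cols : seq (seq Z))
    (x : seq bool) :
  size rows = n -> kernel_certificate n rows cols ->
  (\det (int_of_bool_mx (bool_mx_of_rows n.+1 (rcons rows x))))%R
    = int_of_Z (dot x (nth [::] cols n)).
Proof.
move=> sz_rows /and3P[/eqP U00 /allP szU /allP certU].
pose A : 'M[Z]_n.+1 :=
  (\matrix_(i, j) (nth false (nth [::] (rcons rows x) i) j)%:R)%R.
pose U : 'M[Z]_n.+1 := (\matrix_(i, j) nth 0%Z (nth [::] cols j) i)%R.
have -> : int_of_bool_mx (bool_mx_of_rows n.+1 (rcons rows x))
          = map_mx int_of_Z A.
  by apply/matrixP=> i j; rewrite !mxE rmorph_nat; case: nth.
rewrite det_map_mx; congr int_of_Z.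
have size_col j : j < n.+1 -> size (nth [::] cols j) = j.+1.
  by move=> lt_j; apply/eqP/szU; rewrite mem_iota.
have AUE (i j : 'I_n.+1) :
    (A *m U)%R i j = dot (nth [::] (rcons rows x) i) (nth [::] cols j).
  rewrite mxE (@dotE n.+1) ?size_col //; apply: eq_bigr => k _.
  by rewrite !mxE.
have AUEl (i j : 'I_n.+1) : i < n ->
    (A *m U)%R i j = dot (nth [::] rows i) (nth [::] cols j).
  by move=> lt_i; rewrite AUE nth_rcons sz_rows lt_i.
have in_iota i : i < n -> i \in iota 0 n by rewrite mem_iota.
have rowP i (lt_i : i < n) := certU i (in_iota i lt_i).
rewrite (@det_of_kernel_columns _ _ A U).
- by rewrite AUE nth_rcons sz_rows ltnn eqxx.
- by apply/is_trig_mxP=> j i lt_ji; rewrite !mxE nth_default // size_col.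
- apply/is_trig_mxP=> i j lt_ij.
  have lt_in : i < n by rewrite -ltnS (leq_ltn_trans lt_ij).
  have j_in : (j : nat) \in iota i.+1 (n - i).
    by rewrite mem_iota; have := ltn_ord j; lia.
  by have /and3P[_ _ /allP/(_ _ j_in)/eqP] := rowP i lt_in; rewrite AUEl.
- by rewrite mxE.
- move=> i; have /and3P[/eqP Di _ _] := rowP i (ltn_ord i).
  by rewrite AUEl lift_max // Di mxE.
- move=> i; rewrite mxE; case: (unliftP ord0 i) => [j|] ->; last by rewrite U00.
  by have /and3P[_ nz _] := rowP j (ltn_ord j).
Qed.

(** * Sets of integers as bit strings *)

(** Bit [d] of the result says that [d] is a subset sum of [c].  The sums are
    first computed with an offset [o], the opposite of the least subset sum, so
    that no intermediate sum is negative and shifted out; the final shift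
    removes the offset and drops the negative sums. *)
Definition subset_sums (c : seq Z) : Z :=
  let o := foldr (fun a s => (s + Z.max 0 (- a))%Z) 0%Z c in
  Z.shiftr
    (foldr (fun a S => Z.lor S (Z.shiftl S a)) (Z.shiftl 1 o) c) o.

Lemma subset_sumsP (c : seq Z) (d : Z) : (0 <= d)%Z ->
  Z.testbit (subset_sums c) d -> exists x : seq bool, dot x c = d.
Proof.
rewrite /subset_sums.
set o := foldr _ 0%Z c; set S := foldr _ _ c => d_ge0.
have o_ge0 : (0 <= o)%Z by rewrite /o; elim: c {S o} => //= a c; lia.
rewrite Z.shiftr_spec //.
suff sumP m : Z.testbit S m -> exists x : seq bool, (o + dot x c)%Z = m.
  by case/sumP=> x Dd; exists x; lia.
rewrite {}/S; clearbody o; elim: c m => [|a c IHc] m /=.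
  have [m_lt0|m_ge0] := Z.lt_ge_cases m 0; first by rewrite Z.testbit_neg_r.
  rewrite Z.shiftl_spec // => mo; exists [::] => /=.
  suff: (m - o)%Z = 0%Z by lia.
  by case: (m - o)%Z mo.
have [m_lt0|m_ge0] := Z.lt_ge_cases m 0; first by rewrite Z.testbit_neg_r.
rewrite Z.lor_spec Z.shiftl_spec // => /orP[] /IHc[x Dm].
  by exists (false :: x).
by exists (true :: x) => /=; lia.
Qed.

Fixpoint bits (k : nat) (w : Z) : seq bool :=
  if k is k'.+1 then Z.odd w :: bits k' (Z.div2 w) else [::].

(** The digits of [w] are the entries of [n] rows of length [n.+1], row by row.
    Both signs of the cofactors are used because only the absolute value of the
    determinant matters. *)
Definition det_values (n : nat) (w : Z) : Z :=
  let rows := reshape (nseq n n.+1) (bits (n * n.+1) w) in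
  let cols := kernel_columns rows n.+1 in
  let c := nth [::] cols n in
  if kernel_certificate n rows cols
  then Z.lor (subset_sums c) (subset_sums (map Z.opp c)) else 0%Z.

Lemma det_valuesP (n : nat) (w : Z) (d : nat) :
  Z.testbit (det_values n w) (Z.of_nat d) -> det_spectrum n.+1 d.
Proof.
rewrite /det_values; set rows := reshape _ _; set cols := kernel_columns _ _.
case: ifP => [cert | _]; last by rewrite Z.bits_0.
have sz_rows : size rows = n by rewrite size_reshape size_nseq.
have detP x :
    `|int_of_Z (dot x (nth [::] cols n))|%N = d -> det_spectrum n.+1 d.
  move=> Dd; apply/det_spectrumP/existsP.
  exists (bool_mx_of_rows n.+1 (rcons rows x)).
  by rewrite (det_certified _ _ _ x sz_rows cert) Dd.
have d_ge0 : (0 <= Z.of_nat d)%Z by lia.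
rewrite Z.lor_spec => /orP[] /(subset_sumsP _ _ d_ge0)[x Dx]; apply: (detP x).
  by rewrite Dx; lia.
by move: Dx; rewrite dot_opp; lia.
Qed.

Definition covers (n : nat) (ws : seq Z) (k : nat) : bool :=
  let S := foldr (fun w S => Z.lor (det_values n w) S) 0%Z ws in
  Z.land S (Z.ones (Z.of_nat k)) == Z.ones (Z.of_nat k).

Lemma coversP (n : nat) (ws : seq Z) (k d : nat) :
  covers n ws k -> d < k -> det_spectrum n.+1 d.
Proof.
move=> /eqP cov lt_dk.
have: Z.testbit (Z.ones (Z.of_nat k)) (Z.of_nat d).
  by apply: Z.ones_spec_low; lia.
rewrite -cov Z.land_spec => /andP[+ _].
elim: ws {cov} => [|w ws IHws] /=; first by rewrite Z.bits_0.
by rewrite Z.lor_spec => /orP[/det_valuesP | /IHws].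
Qed.

Lemma smallest_missing_det_ge (n : nat) (ws : seq Z) (k : nat) :
  covers n ws k -> k <= smallest_missing_det n.+1.
Proof.
move=> cov; rewrite leqNgt; apply/negP=> lt_k.
have [_ missing _] := smallest_missing_detP n.+1.
exact: missing (coversP _ _ _ _ cov lt_k).
Qed.

(** * Partial matrices of orders 10 to 13 *)

(** Each number encodes, as in [det_values], all rows but the last of a
    zero-one matrix of the order named by the suffix.  The columns are ordered
    so that all leading principal minors of these rows are nonzero, as
    [kernel_certificate] requires. *)
Definition partial_matrices_10 : seq Z := [::
   0x26c7168f1aef1d6c56f8b37; 0x2dbd1eae7c9cd9f49746fa1;
   0x12bc74b69c4dbe0e4e54965; 0x173db63ae54fc918cbf88a7
]%Z.

Definition partial_matrices_11 : seq Z := [::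
   0x2d945c236597c4e3715d9a9eb2f1; 0x2f49d307f6d38295c771a3b392e5;
   0xc9d638bbb28579f86ed2d31daf1; 0x35647847fb49f51f588ed7390d9b;
   0x3999969e1d701ebb86cba98b558d; 0xb464bb34ab29345c07e71d794b1;
   0x32ceb455719d8bc8ea5a356fd7c1; 0x2728d3472e572b570f9053dd1703;
   0x39b5ce85abf1078f7dc65ae2d755; 0xd93170b6ac73a59c650b3a179e5;
   0x338cdb6bd83c1eab2753bb295067; 0x2cd7851bb9390def1e78fa94b4af
]%Z.

Definition partial_matrices_12 : seq Z := [::
   0x3ab9476e18fd4da76ca72f193d4da2437; 0x573619f83bd81b52d632ecbae644cd85f;
   0xe660af57133ad3c694f815caaf9c1b34d; 0x7979f675a6f052c365c5de2323e0ebbb9;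
   0x5740eaa77f22b58c9c9c56f139655b32d; 0x786ae7cdb1ea2bd6f0c2ef49b32577da1;
   0x6b870ed69e83995a644c48ae437d523e3; 0x15bc61be81afd1c6b9335f0366e7c58d7;
   0x8deed33557c80e7d74b6a63faa4d079b9; 0xc5b8ec2bada2a27bf1e9491e5763cf5bd;
   0xc5a538655de1b495cc06fead997f66783; 0xd237784cff84a6eaa9cf49d3e9a1ae91d;
   0x94b71ee39b95cd2266d2c3e80bf783571; 0x56a8edbb8cd603f1d16a3d31274a5b70d;
   0x39af26a5d55e4bc8f2c2bfe8d916c71e5; 0xdac67e7238e711fc5b3ca1f1b44f96ab9;
   0x5b293e353e359e1547e6af883fc2abcd9; 0xa2e6cad96ba1e45d788996733d471d14f;
   0x17ede46cce71eba82d8d77073b5bca599; 0x39a56c9d9ba5e547c349d2698cecf2177;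
   0xa7738eeb89294af7642c955bdd59e23b1; 0xab0e8bd185a3769fc496e39d4dab53c75;
   0x6455b14e6cdcd0be38bd283717c29f8e9; 0xf85c0f5e32ed6d619f7aa735cfcab3f59;
   0xfedf06ddc67eae733346d1c1a5b695cb; 0xc78be16661f46cdaba35ad8e857593f15;
   0x7c5b7c0b5392c564eae3196325ba8f9d9; 0x95b98ce1e6ab3355c6c912ddf41af2867;
   0xa760bf5649f196bcda3b2bace39d1735d; 0xf994baee13ec68f54b655a5a8d782d333;
   0x4f8f60e1c135ba82e69d435ae93d0e7cd; 0xae3cd9656f4a99eb346ac23b79334d527;
   0xcf0d93c4df1cbc55c69626777692da1bd; 0xb9d728b4baf0c1a7d65b39aed54e274c9;
   0x1b6ce5c3a69474e91df83bc82ad4dbf71; 0x42bb63659456d85e6c5f82b58cf38e93d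
]%Z.

Definition partial_matrices_13 : seq Z := [::
   0xd2672793e8b89aacb51ef490ef18f1b54cd5a33;
   0x625d5e23ceb7241e8b7352330f6cb79931547a9;
   0x625d5e21ceb7241e8b73d2330f6cb79931547a9;
   0xae91e7e770d3446ee69eccaeea5b9e87ba9343b;
   0x9d2f8b86ecc9783deb4163a8edaee1f2f28ed71;
   0x625d5e23cab7241e8b73d2330f6cb79931547a9;
   0x47f4ad701f4d92c3f793ca51739ae4ea8cdebc1;
   0x8d2cb616e355321e0a5d19fcb23f37916456f89;
   0x22b55323e233a41e8b3ed31b176c5f98f14c7a5;
   0x625d5e23ceb7241e8b7ad2730f6cb79931547a9;
   0xec9147e6f0decc5ce556d8ae585e5e8b9e43463;
   0x8b2cb6167351b25a895d19fc723b77816546fc1;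
   0x8e2cae16b351b2368a3d92bcca3eb7c334c6fa1;
   0xae91e1e770d3446ee69accaeea5b9e87ba9343b;
   0x8e6cab26f072b27b2a6926b9a2b48bf1348ece9;
   0x1f9672364d57c7277ac29af87b976b594b57741;
   0x66b55b23e273a41e8b3fd31b176c5f98f14c7a5;
   0x625d5e23ceb7241e9b7bd2330f6cb79931547a9;
   0x1be17b47878e6b5d6367e431377ca31cea95655;
   0x62b55b23e233a41e8b3fd31b176c5f98f14c7a5;
   0xee11d5e7f0dbcc6ce596d4ae705d9e879e1343b;
   0xae91e5e770d3446ee69eccaea25b9e87be1343b;
   0xee115567f0dbcc6ce596d4ae705d9e859e1343b;
   0x1f967a261c4bcf1d7b528cd99793eab3cab6f25;
   0xee11d5e6f05bc46ce596d4ae705d9e879e1343b;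
   0x14f64e9ca7597f126f00eb88f5a75613c6c6f89;
   0xb9aeb45af0bb67a189ed23f1eb7548f32f344f7;
   0xec9147e7f0decc5ce556d8ae585e5e8b9e43463;
   0xe1642edaefb62172d965f7170fd8aa97b392e83;
   0x7780cb6c97baa87e38f8b36973ea60f1a94fa15;
   0x78323bad74fc82cff296ad657459cf1733a4e53;
   0xcec144f52aeb885db3dafc3c2d525d97b66433d;
   0x7e2557265de7065f386f12bda9ac9539f1943f9;
   0x7e2555764de7265b893f53ad29acd53b31863b1;
   0xee117567f0dacc6ce596d4ae705d9ec59e1343b;
   0xae11e5e770d3446ee69eccaeaa5b9e879e1343b;
   0xee115566f0dbcc6ce596d4ae705d9e879e1343b;
   0xec91c7e7e0decc5ce556d8ae585e5e8b9e43463;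
   0x5a76ee2e4c4fce357b49b1f955976a8dc3e6f61;
   0x615d5e236ab7342e8bbad83b0d6e378d3134799;
   0x8e2cae16b353b2368a3f82bcca3eb5c334c6fa1;
   0xae91e1e770d3446ee69eccacea5b9e87ba9343b;
   0x333bc26b4a49b1de7177a657d06e76a191e336b;
   0x7e2557265de7265f182f53bd29ac9d3971941f9;
   0x7ca6aa4b9e96c8dd6d5f9b0af23bcd9b987f4f5;
   0x12f62e9e374d3f126f40b78971ab53718746ee9;
   0xfe0975e7f8cace4d659ad4ce705d9e874e15531;
   0x7e21572659e7265f193f42ad29ac9d3973943f9;
   0xcb4d6badb03abd5b2f13c86f3d9abb5c91bfd91;
   0x691cce978de74257592f12f7e5ec663a6ba415d;
   0x945b8e2f98cd989ebc5f94f85e2378bd0ae5b61;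
   0x1f966e261c57c7355b4394d957976aa7cb96f21;
   0x78e1dae86a9a5be2443f4d82d5f41b33a575dd9;
   0xe5114da7b4dcc44fed1ed0ae525d8f8f1e57479;
   0x276f61b5431331f34761296f38349a2facd5855;
   0x725d5a01fab73d12cf1a94690f6f2715b175f99;
   0x27a0d65e54e4754920ff5d9631cf1f45174b58f;
   0x84cfe2837c66bb7a2b336f1c2de2f4d171c6dd1;
   0x1eae4cf41e47b6e3dc7aad9cd8b7122f9694fa9;
   0xd8ebb305b72aa4f87e0718f4f5aa51d9fca4c3b;
   0x9e8f72059cfa50ddd9a761eb7ac5e55db1c645d;
   0xfee2da43a43bae3dea1ab994b9b92c9d594f91;
   0x768d50ba756e4dd4f25c1f296b1cf695dc5873;
   0xee11d5e7b0dbc46ce596d0ae705d9e859e1343b;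
   0x5cc6c90c7cd873f15732d23acbc7a0d56266d69;
   0x78d7368d6d7c392ea19c176bf0d5556b332fc31;
   0x61fdc4fd4b4696e8f32a1afb0d3b31b734e43ab;
   0x12f62e9e274d7f126f40f38975ab5643c746ac9;
   0x3e1da9267eacc73ad5735e48976dc65961f3e0b;
   0x9be24ddc538ea1e7d2f4acfd0edd0bb10f64dd9;
   0x8c6de0bad0cde1972b0584fbb435cc9dc3e6755;
   0x25ad83e2718d9bea362b8d99171b6c78f54df21;
   0x3c3491c77ab5067664da9a2e33cc5957a5f41e3;
   0xee115567f0dbcc6ce5b6d4ae705d9e879e1343b;
   0x25e6b4388ee69f92287e2fad52bc558cc5cc7d1;
   0x8b74fc4d57d3326bf380b317455d23d4b53c87d;
   0x35b5d409b6e39a87f68f514cec976e1d86d4e47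
]%Z.

Theorem mainTheorem4 :
  [/\ 259 <= smallest_missing_det 10,
      739 <= smallest_missing_det 11,
      2107 <= smallest_missing_det 12 &
      6157 <= smallest_missing_det 13].
Proof.
split.
- by apply: (@smallest_missing_det_ge _ partial_matrices_10); vm_compute.
- by apply: (@smallest_missing_det_ge _ partial_matrices_11); vm_compute.
- by apply: (@smallest_missing_det_ge _ partial_matrices_12); vm_compute.
- by apply: (@smallest_missing_det_ge _ partial_matrices_13); vm_compute.
Qed.
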